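(* Let $L_1$ and $L_2$ be finite-dimensional Lie algebras over a finite field $F$ such that $G_{L_1}\cong G_{L_2}$ as graphs. If there exists a vertex $x\in V(G_{L_1})$ such that $\deg(x)=q$, where $q$ is a prime number, then $|L_1|=|L_2|$.
   Context: For a Lie algebra $L$, $Z(L)=\{x\in L : [x,y]=0 \text{ for all } y\in L\}$ is its centre. The non-commuting graph $G_L$ is the undirected simple graph with vertex set $V(G_L)=L\setminus Z(L)$, in which two distinct vertices $x$ and $y$ are adjacent if and only if $[x,y]\neq 0$. The degree $\deg(x)$ is the number of edges incident to $x$, and $|L|$ is the number of elements of $L$. *)

(* Defs.v *)
From HB Require Import structures.
From mathcomp Require Import all_boot all_algebra all_field.

Set Implicit Arguments.
Unset Strict Implicit.
Unset Printing Implicit Defensive.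

Import GRing.Theory.
Local Open Scope ring_scope.

HB.mixin Record Lmodule_isLieAlgebra (F : fieldType) L of GRing.Lmodule F L := {
  lie_bracket : L -> L -> L;
  lie_bilinear : bilinear_for *:%R *:%R lie_bracket;
  lie_alternating : forall x, lie_bracket x x = 0;
  lie_jacobi : forall x y z,
    lie_bracket x (lie_bracket y z) + lie_bracket y (lie_bracket z x)
      + lie_bracket z (lie_bracket x y) = 0
}.

#[short(type="lieAlgType")]
HB.structure Definition LieAlgebra (F : fieldType) :=
  {L of GRing.Lmodule F L & Lmodule_isLieAlgebra F L}.

(* A vectType is a finite-dimensional vector space. *)
#[short(type="vectLieAlgType")]
HB.structure Definition VectLieAlgebra (F : fieldType) :=
  {L of Vector F L & LieAlgebra F L}.

Notation "[lie x , y ]" := (lie_bracket x y)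
  (at level 0, x, y at level 99, format "[lie  x ,  y ]") : ring_scope.

(* Unlike L, the alias finvect_type L is canonically a finType. *)
HB.instance Definition _ (F : finFieldType) (L : vectLieAlgType F) :=
  VectLieAlgebra.copy (finvect_type L) L.

Lemma lie_anticomm (F : fieldType) (L : lieAlgType F) (x y : L) :
  [lie x, y] = - [lie y, x].
Proof.
have [linl linr] := @lie_bilinear F L.
have addl (u v w : L) : [lie u + v, w] = [lie u, w] + [lie v, w].
  by have := linl w 1 u v; rewrite /= !scale1r.
have addr (u v w : L) : [lie u, v + w] = [lie u, v] + [lie u, w].
  by have := linr u 1 v w; rewrite /= !scale1r.
have := lie_alternating (x + y).
rewrite addl !addr !lie_alternating add0r addr0 => /eqP.
by rewrite addr_eq0 => /eqP.
Qed.

Record sgraph := SGraph {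
  vertex :> finType;
  adj : rel vertex;
  adj_sym : symmetric adj;
  adj_irrefl : irreflexive adj
}.

Definition edges (G : sgraph) : {set {set G}} :=
  [set [set u; v] | u in [set: G], v in [set w | adj u w]].

Definition degree (G : sgraph) (x : G) : nat :=
  #|[set e in edges G | x \in e]|.

Definition graph_iso (G H : sgraph) : Prop :=
  exists f : G -> H, bijective f /\ forall u v, adj (f u) (f v) = adj u v.

Section NonCommutingGraph.
Variables (F : finFieldType) (L : vectLieAlgType F).

Definition lie_center : {set finvect_type L} :=
  [set x : finvect_type L | [forall y : finvect_type L, [lie x, y] == 0]].

Definition noncomm_vertex := {x : finvect_type L | x \notin lie_center}.

Definition noncomm_adj : rel noncomm_vertex :=
  fun x y => (x != y) && ([lie val x, val y] != 0).

Lemma noncomm_adj_sym : symmetric noncomm_adj.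
Proof.
by move=> x y; rewrite /noncomm_adj eq_sym lie_anticomm oppr_eq0.
Qed.

Lemma noncomm_adj_irrefl : irreflexive noncomm_adj.
Proof. by move=> x; rewrite /noncomm_adj eqxx. Qed.

Definition noncomm_graph : sgraph := SGraph noncomm_adj_sym noncomm_adj_irrefl.

End NonCommutingGraph.

(* Main.v *)
Require Import Defs.
From HB Require Import structures.
From mathcomp Require Import all_boot all_algebra all_field.

(** In both graphs a vertex of prime degree [q] forces the order of the Lie
algebra to be [2 * q], and isomorphic graphs have the same degrees, so the two
orders agree.

For the order, a non-central [x] is joined exactly to the elements outside its
centralizer [C], whence [deg x = |L| - |C|].  Since [C] is the kernel of the
linear map [ad x], [|C|] divides [|L|], say [|L| = k * |C|], and
[q = (k - 1) * |C|].  The centralizer contains the two distinct elements [0] and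
[x], so the divisor [|C|] of the prime [q] is [q] itself and [k = 2]. *)

Set Implicit Arguments.
Unset Strict Implicit.
Unset Printing Implicit Defensive.

Import GRing.Theory.
Local Open Scope ring_scope.

(** The edges at [x] correspond to the neighbours of [x]: [w |-> {x, w}] is
injective on neighbours because [x] is not its own neighbour. *)
Lemma degree_card_neighbours (G : sgraph) (x : G) :
  degree x = #|[set w | adj x w]|.
Proof.
have adj_neq (u v : G) : adj u v -> v != u.
  by apply: contraTneq => ->; rewrite adj_irrefl.
rewrite /degree -(@card_in_imset _ _ (fun w => [set x; w])); last first.
  move=> u v; rewrite !inE => xu _ /setP/(_ u).
  by rewrite !inE eqxx orbT (negPf (adj_neq _ _ xu)) => /esym/eqP.
apply: eq_card => e; rewrite inE; apply/andP/imsetP => [[]|[w]].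
  case/imset2P=> u v _; rewrite !inE => uv -> /set2P[xu|xv].
    by exists v; rewrite ?inE xu.
  by exists u; rewrite ?inE xv 1?adj_sym // setUC.
rewrite inE => xw ->; split; last by rewrite set21.
by apply/imset2P; exists x w; rewrite ?inE.
Qed.

Lemma degree_iso (G H : sgraph) (f : G -> H) (x : G) :
  bijective f -> (forall u v, adj (f u) (f v) = adj u v) ->
  degree (f x) = degree x.
Proof.
move=> [g fK gK] f_adj; rewrite !degree_card_neighbours.
rewrite -(card_imset _ (can_inj fK)); apply: eq_card => w.
by rewrite (can2_imset_pre _ fK gK) !inE -{1}(gK w) f_adj.
Qed.

Section Centralizer.
Variables (F : finFieldType) (L : vectLieAlgType F).
Implicit Types x y : finvect_type L.

Lemma lie_bracket_is_linear (x : finvect_type L) : linear (lie_bracket x).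
Proof. by move=> a u v; have [_ /(_ x a u v)] := @lie_bilinear F L. Qed.

HB.instance Definition _ (x : finvect_type L) :=
  GRing.isLinear.Build F (finvect_type L) (finvect_type L) *:%R
    (lie_bracket x) (lie_bracket_is_linear x).

Definition lie_centralizer x : {set finvect_type L} :=
  [set y | [lie x, y] == 0].

(** The centralizer is the kernel of [ad x], a subspace, so both orders are
powers of [#|F|], with exponents ordered like the dimensions. *)
Lemma card_lie_centralizer_dvd x :
  (#|lie_centralizer x| %| #|finvect_type L|)%N.
Proof.
have -> : #|lie_centralizer x| = #|lker (linfun (lie_bracket x))|.
  by apply: eq_card => y; rewrite inE memv_ker lfunE.
have -> : #|finvect_type L| = #|{: finvect_type L}%VS|.
  by apply: eq_card => y; rewrite memvf.
rewrite !card_vspace.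
by rewrite dvdn_exp2l // dimvS // subvf.
Qed.

Lemma card_lie_centralizer_gt1 x :
  x \notin lie_center L -> (1 < #|lie_centralizer x|)%N.
Proof.
move=> x_nc; have x_neq0 : x != 0.
  apply: contraNneq x_nc => ->; rewrite inE; apply/forallP => y.
  by rewrite lie_anticomm linear0 oppr0.
apply: leq_trans (subset_leq_card (_ : [set 0; x] \subset _)).
  by rewrite cards2 eq_sym x_neq0.
by rewrite subUset !sub1set !inE linear0 lie_alternating eqxx.
Qed.

(** Whatever does not commute with [x] is automatically non-central and distinct
from [x], so neither the restriction to vertices nor the absence of loops
excludes any element from the neighbourhood of [x]. *)
Lemma degree_noncomm (x : noncomm_graph L) :
  degree x = #|~: lie_centralizer (val x)|.
Proof.
rewrite degree_card_neighbours -(card_imset _ val_inj).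
apply: eq_card => y; rewrite !inE; apply/imsetP/idP => [[w]|xy].
  by rewrite inE => /andP[_ ?] ->.
have y_nc : y \notin lie_center L.
  apply: contra xy; rewrite inE => /forallP/(_ (val x)).
  by rewrite lie_anticomm oppr_eq0.
exists (Sub y y_nc : noncomm_vertex L) => //.
rewrite inE /= /noncomm_adj xy andbT.
by apply: contraNneq xy => ->; rewrite lie_alternating.
Qed.

Lemma card_of_prime_degree (x : noncomm_graph L) :
  prime (degree x) -> #|finvect_type L| = (2 * degree x)%N.
Proof.
move=> q_pr; set C := lie_centralizer (val x).
have cardL : (#|C| + degree x)%N = #|finvect_type L|.
  by rewrite degree_noncomm cardsC.
have C_dvd : (#|C| %| degree x)%N.
  by have := card_lie_centralizer_dvd (val x); rewrite -cardL dvdn_addr.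
have C_gt1 : (1 < #|C|)%N := card_lie_centralizer_gt1 (valP x).
have /eqP C_eq : #|C| == degree x.
  by move/primeP: q_pr => [_ /(_ _ C_dvd)]; rewrite gtn_eqF.
by rewrite -cardL C_eq mul2n addnn.
Qed.

End Centralizer.

Theorem theorem4p2 (F : finFieldType) (L1 L2 : vectLieAlgType F)
    (hiso : graph_iso (noncomm_graph L1) (noncomm_graph L2))
    (x : noncomm_graph L1) (q : nat) (hq : prime q) (hdeg : degree x = q) :
  #|finvect_type L1| = #|finvect_type L2|.
Proof.
have [f [f_bij f_adj]] := hiso.
have deg_fx : degree (f x) = degree x := degree_iso x f_bij f_adj.
by rewrite (@card_of_prime_degree _ _ x) ?(@card_of_prime_degree _ _ (f x))
  ?deg_fx ?hdeg.
Qed.
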